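(* The longest (strictly ascending) chain of nonempty faces in the doubly nonnegative cone $\mathcal{D}^n$ has length $\frac{n(n+1)}{2} + 1$, which is the maximum possible for a cone contained in $\mathcal{S}^n$ (that is, for every closed convex cone contained in $\mathcal{S}^n$, every strictly ascending chain of its nonempty faces has length at most $\frac{n(n+1)}{2}+1$).
   Context: $\mathcal{S}^n$ is the space of $n\times n$ real symmetric matrices, and $\mathcal{D}^n=\mathcal{S}^n_+\cap\mathcal{N}^n$, where $\mathcal{S}^n_+$ is the cone of positive semidefinite matrices and $\mathcal{N}^n$ the cone of symmetric matrices with nonnegative entries. The length of a chain $\mathcal{F}_1\subsetneq\cdots\subsetneq\mathcal{F}_\ell$ is $\ell$. *)

(* Defs.v *)
From HB Require Import structures.
From mathcomp Require Import all_boot all_order all_algebra.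
From mathcomp Require Import all_classical all_reals all_analysis.

Set Implicit Arguments.
Unset Strict Implicit.
Unset Printing Implicit Defensive.

Import Order.TTheory GRing.Theory Num.Theory.
Import numFieldNormedType.Exports.

Local Open Scope classical_set_scope.
Local Open Scope ring_scope.

Definition sym_space (R : realType) (n : nat) : set 'M[R]_n :=
  [set A | A \is symmetricmx].
Arguments sym_space : clear implicits.

Definition psd_cone (R : realType) (n : nat) : set 'M[R]_n :=
  [set A | sym_space R n A /\ forall x : 'cV[R]_n, 0 <= (x^T *m A *m x) 0 0].
Arguments psd_cone : clear implicits.

Definition nonneg_cone (R : realType) (n : nat) : set 'M[R]_n :=
  [set A | sym_space R n A /\ forall i j, 0 <= A i j].
Arguments nonneg_cone : clear implicits.

Definition dnn_cone (R : realType) (n : nat) : set 'M[R]_n :=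
  psd_cone R n `&` nonneg_cone R n.
Arguments dnn_cone : clear implicits.

Definition convex_cone (R : realType) (V : lmodType R) (K : set V) : Prop :=
  convex_set K /\ forall (t : R) x, 0 <= t -> K x -> K (t *: x).

(* The empty set is a face of every K: this is why chains below ask for
   nonempty faces. The nonempty faces of a convex cone contain 0 and are
   convex cones themselves. *)
Definition face (R : realType) (V : lmodType R) (K F : set V) : Prop :=
  [/\ convex_set F, F `<=` K &
      forall (x y : V) (t : R), K x -> K y -> 0 < t < 1 ->
        F (t *: x + (1 - t) *: y) -> F x /\ F y].

Definition face_chain (R : realType) (V : lmodType R) (K : set V)
    (l : nat) (F : 'I_l -> set V) : Prop :=
  (forall i, face K (F i) /\ F i !=set0) /\
  (forall i j : 'I_l, (i < j)%N -> F i `<` F j).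

Definition longest_face_chain_length (R : realType) (V : lmodType R)
    (K : set V) (l : nat) : Prop :=
  (exists F : 'I_l -> set V, face_chain K F) /\
  (forall (m : nat) (F : 'I_m -> set V), face_chain K F -> (m <= l)%N).

(* Main.v *)
(* Upper bound: picking a point of each face outside the previous one gives a
   linearly independent family of symmetric matrices. Indeed a nonempty face F
   of a cone K is a cone, so a point v of K in the span of F is v = a - b with
   a, b in F; then a/2 = v/2 + b/2 lies in F, hence so does v.

   Lower bound: let the entries of a doubly nonnegative matrix be nonzero one
   symmetric position at a time, diagonal positions first and then by increasing
   distance to the diagonal. Each set of zero constraints cuts out a face because
   entries are nonnegative, and the matrix (e_i + e_j)(e_i + e_j)^T shows that
   freeing position (i, j) strictly enlarges the face. *)

Require Import Defs.
From HB Require Import structures.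
From mathcomp Require Import all_boot all_order all_algebra.
From mathcomp Require Import all_classical all_reals all_analysis.
From mathcomp Require Import ring lra zify.

Set Implicit Arguments.
Unset Strict Implicit.
Unset Printing Implicit Defensive.

Import Order.TTheory GRing.Theory Num.Theory.
Import numFieldNormedType.Exports.

Local Open Scope classical_set_scope.
Local Open Scope ring_scope.

Lemma convex_setP (R : realType) (V : lmodType R) (A : set V) :
  convex_set A <-> forall x y (t : R), 0 <= t <= 1 -> A x -> A y ->
    A (t *: x + (1 - t) *: y).
Proof.
split=> [cA x y t /andP[t0 t1] Ax Ay|cA x y t].
  by have := cA x y (Itv01 t0 t1); rewrite !inE; apply.
by rewrite !inE; apply: cA; rewrite ge0 le1.
Qed.

Lemma convex_cone_of_closed (R : realType) (V : lmodType R) (K : set V) :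
  (forall x y, K x -> K y -> K (x + y)) ->
  (forall (t : R) x, 0 <= t -> K x -> K (t *: x)) -> convex_cone K.
Proof.
move=> KD KZ; split=> //; apply/convex_setP => x y t /andP[t0 t1] Kx Ky.
by apply: KD; apply: KZ => //; rewrite subr_ge0.
Qed.

(** * Nonempty faces of a convex cone *)

Section FacesOfCones.
Variables (R : realType) (V : lmodType R) (K : set V).
Hypothesis coneK : convex_cone K.

Section Face.
Variable F : set V.
Hypotheses (faceF : face K F) (F_neq0 : F !=set0).

Lemma face_split x y : K x -> K y -> F (2^-1 *: x + 2^-1 *: y) -> F x.
Proof.
case: faceF => _ _ splitF Kx Ky.
rewrite [X in _ + X *: _](_ : _ = 1 - 2^-1); last by field.
by case/splitF => //; lra.
Qed.

(** Any [x] in [F] is the midpoint of [0] and [2 *: x], both of which lie in [K]. *)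
Lemma face0 : F 0.
Proof.
case: coneK => _ KZ; case: F_neq0 => x Fx.
have Kx : K x by case: faceF => _ + _; apply.
apply: (@face_split 0 (2 *: x)); first by rewrite -(scale0r x); apply: KZ.
  by apply: KZ.
by rewrite scaler0 add0r scalerA mulVf ?scale1r// pnatr_eq0.
Qed.

(** For [t <= 1], [t *: x] is a convex combination of [x] and [0]. For [t > 1], [x] is the
    combination of [t *: x] and [0] with weight [t^-1] on the former, and the face property
    applies. *)
Lemma faceZ (t : R) x : 0 <= t -> F x -> F (t *: x).
Proof.
move=> t0 Fx; case: faceF => /convex_setP cF FK splitF.
have [t1|t1] := leP t 1.
  rewrite -[_ *: x]addr0 -(scaler0 _ (1 - t)).
  by apply: cF; rewrite ?t0//; apply: face0.
have tn0 : t != 0 by rewrite gt_eqF// (lt_trans ltr01).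
apply: (proj1 (splitF _ 0 t^-1 _ _ _ _)).
- by case: coneK => _; apply => //; apply: FK.
- by apply: FK; apply: face0.
- by rewrite invr_gt0 (lt_trans ltr01)//= invf_lt1// (lt_trans ltr01).
- by rewrite scaler0 addr0 scalerA mulVf// scale1r.
Qed.

Lemma faceD x y : F x -> F y -> F (x + y).
Proof.
move=> Fx Fy; case: faceF => /convex_setP cF _ _.
have := cF x y 2^-1; rewrite [1 - _](_ : _ = 2^-1); last by field.
rewrite -scalerDr => /(_ _ Fx Fy) F2.
rewrite -[x + y]scale1r -(@mulfV _ 2) ?pnatr_eq0// -scalerA.
by apply: faceZ => //; apply: F2; lra.
Qed.

Lemma face_sub x y : F x -> F y -> K (x - y) -> F (x - y).
Proof.
move=> Fx Fy Kxy; apply: (@face_split _ y) => //.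
  by case: faceF => _ + _; apply.
by rewrite -scalerDr subrK; apply: faceZ => //; rewrite invr_ge0.
Qed.

End Face.
End FacesOfCones.

(** * Linear independence along a chain of faces *)

Lemma face_span (R : realType) (V : vectType R) (K F : set V) (X : seq V) v :
  convex_cone K -> face K F -> F !=set0 -> (forall x, x \in X -> F x) ->
  v \in <<X>>%VS -> K v -> F v.
Proof.
move=> coneK faceF F0 FX /(@coord_span _ _ _ (in_tuple X)) vE Kv.
(* Terms with nonnegative coefficients go into [a], the opposites of the others into [b]. *)
have [a [b [Fa Fb vab]]] : exists a b, [/\ F a, F b & v = a - b].
  rewrite vE; elim/big_ind: _ => [|_ _ [a [b [Fa Fb ->]]] [c [d [Fc Fd ->]]]|i _].
  - by exists 0, 0; rewrite subr0; split=> //; apply: (face0 coneK).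
  - exists (a + c), (b + d); split; [exact: (faceD coneK)|exact: (faceD coneK)|].
    by rewrite opprD addrACA.
  - set c := coord _ _ _.
    have Fi : F (in_tuple X)`_i by apply: FX; apply: mem_nth.
    have [c0|c0] := leP 0 c.
      exists (c *: (in_tuple X)`_i), 0; rewrite subr0.
      by split=> //; [apply: (faceZ coneK)|apply: (face0 coneK)].
    exists 0, (- c *: (in_tuple X)`_i); rewrite sub0r scaleNr opprK.
    split=> //; [exact: (face0 coneK)|rewrite -scaleNr].
    by apply: (faceZ coneK) => //; rewrite oppr_ge0 ltW.
by rewrite vab; apply: (face_sub coneK) => //; rewrite -vab.
Qed.

(** Each face after the first supplies one new vector. The first supplies none, since it may be
    [{0}]; hence [m] vectors from [m.+1] faces. *)
Lemma face_chain_free (R : realType) (V : vectType R) (K : set V) (m : nat)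
    (F : 'I_m.+1 -> set V) :
  convex_cone K -> face_chain K F ->
  exists X : seq V, [/\ size X = m, free X & forall x, x \in X -> K x].
Proof.
move=> coneK [faceF chainF].
have FK i : F i `<=` K by case: (faceF i) => -[].
suff freeX k : (k <= m)%N -> exists X : seq V,
    [/\ size X = k, free X & forall x, x \in X -> F (inord k) x].
  by have [X [szX fX FX]] := freeX m (leqnn m); exists X; split=> // x /FX /FK.
elim: k => [_|k IHk lekm].
  by exists [::]; rewrite nil_free.
have [X [szX fX FX]] := IHk (ltnW lekm).
have [Fkk /nonsubset[v [Fv NFv]]] : F (inord k) `<` F (inord k.+1).
  by apply: chainF; rewrite !inordK// ltnS ltnW.
exists (v :: X); split; first by rewrite /= szX.
  rewrite free_cons fX andbT; apply/negP => vX; apply: NFv.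
  have [faceFk Fk0] := faceF (inord k).
  by apply: (face_span coneK faceFk Fk0 FX vX); apply: FK Fv.
by move=> x; rewrite inE => /predU1P[->//|/FX /Fkk].
Qed.

(** * Dimension bound for symmetric matrices *)

Lemma sym_spaceP (R : realType) (n : nat) (A : 'M[R]_n) :
  sym_space R n A <-> forall i j, A i j = A j i.
Proof.
split=> [/is_hermitianmxP symA i j|symA].
  by rewrite [in LHS]symA expr0 scale1r !mxE.
by apply/is_hermitianmxP/matrixP => i j; rewrite expr0 scale1r !mxE.
Qed.

(** Each symmetric position is represented by its pair on or below the diagonal. *)
Definition lower_pair n : pred ('I_n * 'I_n) := fun p => (p.2 <= p.1)%N.

Lemma card_lower_pair n : #|@lower_pair n| = ((n * (n + 1)) %/ 2)%N.
Proof.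
have -> : #|@lower_pair n| = (\sum_(i < n) i.+1)%N.
  rewrite -sum1_card -(pair_big_dep xpredT (fun i j : 'I_n => j <= i)%N
    (fun _ _ => 1%N)) /=.
  apply: eq_bigr => i _.
  rewrite -(big_ord_widen n (fun=> 1%N) (ltn_ord i)).
  by rewrite sum_nat_const card_ord muln1.
suff: ((\sum_(i < n) i.+1) * 2 = n * (n + 1))%N by lia.
elim: n => [|n IHn]; first by rewrite big_ord0.
by rewrite big_ord_recr mulnDl IHn /=; lia.
Qed.

(** The disjunction, rather than a sum of two matrix units, keeps the nonzero entry equal to 1 on
    the diagonal too. *)
Definition sym_unit_mx (R : realType) n (p : 'I_n * 'I_n) : 'M[R]_n :=
  \matrix_(i, j) (((i, j) == p) || ((j, i) == p))%:R.

Lemma sum_sym_unit_mx (R : realType) n (A : 'M[R]_n) : sym_space R n A ->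
  A = \sum_(p | lower_pair p) A p.1 p.2 *: sym_unit_mx R p.
Proof.
move=> /sym_spaceP symA; apply/matrixP => i j; rewrite summxE.
wlog leji : i j / (j <= i)%N => [IH|].
  have [/IH//|/ltnW/IH Aji] := leqP j i.
  rewrite symA Aji; apply: eq_bigr => p _.
  by rewrite !mxE orbC.
rewrite (bigD1 (i, j))//= !mxE eqxx mulr1 big1 ?addr0//.
(* Another lower pair could only contribute as the transpose of [(i, j)]; both pairs being lower,
   this forces [i = j], hence [(k, l) = (i, j)]. *)
move=> [k l] /andP[/= lelk neq].
rewrite !mxE eq_sym (negPf neq)/=; case: eqP => [[jk il]|]; rewrite ?mulr0//.
case/eqP: neq; congr pair; apply/val_inj; subst k l => /=;
  by move: lelk; rewrite /lower_pair /=; lia.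
Qed.

(** The span of [X] lies in that of the matrices [sym_unit_mx R p] with [p] lower, whose dimension
    is at most their number. *)
Lemma free_sym_size (R : realType) n (X : seq 'M[R]_n) : free X ->
  (forall A, A \in X -> sym_space R n A) -> (size X <= (n * (n + 1)) %/ 2)%N.
Proof.
move=> /eqP <- symX; rewrite -card_lower_pair cardE.
rewrite -(size_map (@sym_unit_mx R n)); apply: leq_trans (dim_span _).
apply/dimvS/span_subvP => A /symX /sum_sym_unit_mx ->.
apply: memv_suml => p lep; apply: memvZ; apply: memv_span.
by apply: map_f; rewrite mem_enum.
Qed.

Lemma face_chain_sym_bound (R : realType) n (K : set 'M[R]_n) l
    (F : 'I_l -> set 'M[R]_n) :
  convex_cone K -> K `<=` sym_space R n -> face_chain K F ->
  (l <= (n * (n + 1)) %/ 2 + 1)%N.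
Proof.
case: l F => // l F coneK symK /(face_chain_free coneK)[X [<- fX KX]].
by rewrite addn1 ltnS; apply: free_sym_size => // A /KX /symK.
Qed.

(** * Faces of the doubly nonnegative cone given by zero patterns *)

Lemma dnn_sym (R : realType) n : dnn_cone R n `<=` sym_space R n.
Proof. by move=> A [[]]. Qed.

Lemma dnn_convex_cone (R : realType) n : convex_cone (dnn_cone R n).
Proof.
apply: convex_cone_of_closed => [A B [[sA pA] [_ nA]] [[sB pB] [_ nB]]|].
  have sAB : sym_space R n (A + B).
    apply/sym_spaceP => i j; rewrite !mxE.
    by move/sym_spaceP: sA => ->; move/sym_spaceP: sB => ->.
  split; split=> //; [move=> x|move=> i j].
    by rewrite mulmxDr mulmxDl mxE addr_ge0.
  by rewrite mxE addr_ge0.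
move=> t A t0 [[sA pA] [_ nA]].
have stA : sym_space R n (t *: A).
  by apply/sym_spaceP => i j; rewrite !mxE; move/sym_spaceP: sA => ->.
split; split=> //; [move=> x|move=> i j]; last by rewrite mxE mulr_ge0.
by rewrite -scalemxAr -scalemxAl mxE mulr_ge0.
Qed.

Definition dnn_zeros (R : realType) n (s : seq ('I_n * 'I_n)) : set 'M[R]_n :=
  [set A | dnn_cone R n A /\ forall p, p \in s -> A p.1 p.2 = 0].
Arguments dnn_zeros R {n} s.

Lemma dnn_zeros_face (R : realType) n (s : seq ('I_n * 'I_n)) :
  face (dnn_cone R n) (dnn_zeros R s).
Proof.
have [/convex_setP cD _] := dnn_convex_cone R n.
split=> [|A []//|A B t DA DB /andP[t0 t1] [_ ABs]].
  apply/convex_setP => A B t t01 [DA As] [DB Bs]; split; first exact: cD.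
  by move=> p ps; rewrite !mxE As// Bs// !mulr0 addr0.
have [_ [_ nA]] := DA; have [_ [_ nB]] := DB.
have AB0 p : p \in s -> A p.1 p.2 = 0 /\ B p.1 p.2 = 0.
  (* A vanishing sum of nonnegative terms has vanishing terms, and both weights are positive. *)
  move=> /ABs /eqP; rewrite !mxE paddr_eq0 ?mulr_ge0 ?subr_ge0// ?ltW//.
  rewrite !mulf_eq0 subr_eq0 [t == 0]gt_eqF// [1 == t]gt_eqF//=.
  by case/andP => /eqP + /eqP.
by split; split=> // p /AB0[].
Qed.

Lemma dnn_zeros_neq0 (R : realType) n (s : seq ('I_n * 'I_n)) :
  dnn_zeros R s !=set0.
Proof.
exists 0; split=> [|p _]; last by rewrite mxE.
have s0 : sym_space R n 0 by apply/sym_spaceP => i j; rewrite !mxE.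
by split; split=> //; [move=> x|move=> i j]; rewrite ?mulmx0 ?mul0mx mxE.
Qed.

(** On the diagonal, where [p.1 = p.2], this is twice a basis vector, so its support is still the
    set of coordinates of [p]. *)
Definition pair_col (R : realType) n (p : 'I_n * 'I_n) : 'cV[R]_n :=
  delta_mx p.1 0 + delta_mx p.2 0.

Definition pair_mx (R : realType) n (p : 'I_n * 'I_n) : 'M[R]_n :=
  pair_col R p *m (pair_col R p)^T.

Lemma pair_colE (R : realType) n (p : 'I_n * 'I_n) i :
  pair_col R p i 0 = (i == p.1)%:R + (i == p.2)%:R.
Proof. by rewrite !mxE !andbT. Qed.

Lemma pair_col_neq0 (R : realType) n (p : 'I_n * 'I_n) i :
  (pair_col R p i 0 != 0) = (i == p.1) || (i == p.2).
Proof.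
by rewrite pair_colE -natrD pnatr_eq0 addn_eq0 !eqb0 negb_and !negbK.
Qed.

Lemma pair_mxE (R : realType) n (p : 'I_n * 'I_n) i j :
  pair_mx R p i j = pair_col R p i 0 * pair_col R p j 0.
Proof. by rewrite mxE big_ord1 [_^T _ _]mxE. Qed.

Lemma dnn_pair_mx (R : realType) n (p : 'I_n * 'I_n) :
  dnn_cone R n (pair_mx R p).
Proof.
have sp : sym_space R n (pair_mx R p).
  by apply/sym_spaceP => i j; rewrite !pair_mxE mulrC.
split; split=> //; [move=> x|move=> i j]; last first.
  by rewrite pair_mxE !pair_colE mulr_ge0// addr_ge0.
(* The quadratic form at [x] is the square of [x^T *m pair_col R p]. *)
rewrite /pair_mx mulmxA -mulmxA -[X in _ *m X]trmxK trmx_mul trmxK.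
by rewrite mxE big_ord1 [_^T _ _]mxE -expr2 sqr_ge0.
Qed.

Lemma pair_mx_neq0 (R : realType) n (p : 'I_n * 'I_n) :
  pair_mx R p p.1 p.2 != 0.
Proof.
by rewrite pair_mxE mulf_neq0// pair_col_neq0 eqxx ?orbT.
Qed.

(* The other lower entries of the support of [pair_mx p] are diagonal, hence
   vanish once all entries closer to the diagonal than [p] are kept. *)
Lemma pair_mx_eq0 (R : realType) n (p q : 'I_n * 'I_n) :
  lower_pair p -> lower_pair q -> q != p -> (p.1 - p.2 <= q.1 - q.2)%N ->
  pair_mx R p q.1 q.2 = 0.
Proof.
rewrite /lower_pair; case: p q => [i j] [k l] /= leji lelk neq le_pq.
apply/eqP; rewrite pair_mxE; apply: contraNT neq.
rewrite mulf_eq0 negb_or !pair_col_neq0 xpair_eqE -!val_eqE /=; lia.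
Qed.

(** * The chain of maximal length *)

(** On lower pairs the truncated difference is the distance to the diagonal. Positions at equal
    distance may come in any order. *)
Definition closer_diag n : rel ('I_n * 'I_n) :=
  fun p q => (p.1 - p.2 <= q.1 - q.2)%N.

Definition lower_pairs n : seq ('I_n * 'I_n) :=
  sort (@closer_diag n) (enum (@lower_pair n)).

(** Face [i] leaves the first [i] positions of [lower_pairs n] free, so the chain runs from [{0}] to
    the whole cone and has one face more than there are positions. *)
Lemma dnn_zeros_chain (R : realType) n :
  face_chain (dnn_cone R n)
    (fun i : 'I_((n * (n + 1)) %/ 2 + 1) => dnn_zeros R (drop i (lower_pairs n))).
Proof.
split=> [i|i j ltij].
  by split; [exact: dnn_zeros_face|exact: dnn_zeros_neq0].
set s := lower_pairs n.
have szs : size s = ((n * (n + 1)) %/ 2)%N.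
  by rewrite size_sort -cardE card_lower_pair.
have us : uniq s by rewrite sort_uniq enum_uniq.
have lows p : p \in s -> lower_pair p by rewrite mem_sort mem_enum.
have ltis : (i < size s)%N.
  rewrite szs -(ltn_add2r 1); apply: leq_ltn_trans (ltn_ord j).
  by rewrite addn1.
split.
  move=> A [DA As]; split=> // p pj; apply: As.
  move: pj; rewrite -(subnK (ltnW ltij)) -drop_drop; exact: mem_drop.
have p0 : 'I_n * 'I_n by case: (s) ltis => [//|p0].
(* Position [p] is constrained in face [i] but free in face [j], so [pair_mx R p] separates them:
   the positions still constrained in face [j] come after [p] in the sorted list, hence differ from
   [p] and are no closer to the diagonal. *)
set p := nth p0 s i.
have ps : p \in s by apply: mem_nth.
move=> /(_ (pair_mx R p))[].
  split=> [|q /(nthP p0)[k]]; first exact: dnn_pair_mx.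
  rewrite size_drop nth_drop => ltk <-.
  have ltjk : (j + k < size s)%N by rewrite -ltn_subRL.
  have ltijk : (i < j + k)%N by rewrite ltn_addr.
  apply: pair_mx_eq0.
  - exact: lows.
  - by apply: lows; apply: mem_nth.
  - by rewrite nth_uniq// gtn_eqF.
  - apply: (@sorted_ltn_nth _ (@closer_diag n)) => //.
      by move=> a b c; apply: leq_trans.
    by apply: sort_sorted => a b; apply: leq_total.
move=> _ /(_ p); rewrite (drop_nth p0)// mem_head => /(_ isT)/eqP.
by rewrite (negPf (pair_mx_neq0 R p)).
Qed.

Theorem proposition21 (R : realType) (n : nat) :
  longest_face_chain_length (dnn_cone R n) ((n * (n + 1)) %/ 2 + 1)
  /\
  (forall K : set 'M[R]_n,
     closed K -> convex_cone K -> K `<=` sym_space R n ->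
     forall (l : nat) (F : 'I_l -> set 'M[R]_n),
       face_chain K F -> (l <= (n * (n + 1)) %/ 2 + 1)%N).
Proof.
split=> [|K _ coneK symK l F]; last exact: face_chain_sym_bound.
split; first by eexists; apply: dnn_zeros_chain.
by move=> m F; apply: face_chain_sym_bound; [exact: dnn_convex_cone|exact: dnn_sym].
Qed.
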